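(* Let $\mathcal A$ be a commutative unital C*-algebra and let $\mathcal M$ be a full Hilbert $\mathcal A$-module. Then each derivation on $\mathrm{End}_{\mathcal A}(\mathcal M)$ is continuous (with respect to the operator norm).
   Context: C*-algebras are complex. A Hilbert $\mathcal A$-module is a left $\mathcal A$-module $\mathcal M$ with an $\mathcal A$-valued inner product $\langle\cdot,\cdot\rangle:\mathcal M\times\mathcal M\to\mathcal A$ satisfying, for $\lambda\in\mathbb C$, $a\in\mathcal A$, $x,y,z\in\mathcal M$: $\langle x,x\rangle\ge 0$, and $\langle x,x\rangle=0$ implies $x=0$; $\langle\lambda x+y,z\rangle=\lambda\langle x,z\rangle+\langle y,z\rangle$; $\langle ax,y\rangle=a\langle x,y\rangle$; $\langle x,y\rangle=\langle y,x\rangle^*$; and such that $\mathcal M$ is complete for the norm $\|x\|=\|\langle x,x\rangle\|^{1/2}$. $\mathcal M$ is full if the closed linear span of $\{\langle x,y\rangle:x,y\in\mathcal M\}$ equals $\mathcal A$. A linear map $T:\mathcal M\to\mathcal M$ is $\mathcal A$-linear if $T(ax)=aT(x)$ for all $a\in\mathcal A$, $x\in\mathcal M$. $\mathrm{End}_{\mathcal A}(\mathcal M)$ is the Banach algebra (operator norm, composition) of all bounded $\mathcal A$-linear maps $\mathcal M\to\mathcal M$. A derivation on an algebra $\mathcal B$ is a ($\mathbb C$-)linear map $d:\mathcal B\to\mathcal B$ with $d(xy)=d(x)y+xd(y)$ for all $x,y\in\mathcal B$. *)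

(* Defs.v *)
From HB Require Import structures.
From mathcomp Require Import all_boot all_order all_algebra.
From mathcomp Require Import all_classical all_reals all_analysis.
From mathcomp Require Import complex.

Set Implicit Arguments.
Unset Strict Implicit.
Unset Printing Implicit Defensive.

Import Order.TTheory GRing.Theory Num.Theory.
Import numFieldNormedType.Exports.

Local Open Scope classical_set_scope.
Local Open Scope ring_scope.
Local Open Scope complex_scope.

(* The complex numbers are [R[i]] for [R : realType], so norms are valued in
   [R[i]]; the order of [R[i]] satisfies [0 <= z] iff [z] is real and
   nonnegative.  The ring operations are fields of this mixin, and the ring
   structure is recovered just below, because Hierarchy Builder rejects a join
   of rings and normed modules (these already meet in [numDomainType]).
   The zero algebra is not excluded. *)
HB.mixin Record isUnitalCStarAlgebra (R : realType) A
    of CompleteNormedModule R[i] A := {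
  cstar_one : A ;
  cstar_mul : A -> A -> A ;
  cstar_mulA : associative cstar_mul ;
  cstar_mul1r : left_id cstar_one cstar_mul ;
  cstar_mulr1 : right_id cstar_one cstar_mul ;
  cstar_mulDl : left_distributive cstar_mul +%R ;
  cstar_mulDr : right_distributive cstar_mul +%R ;
  cstar_scaleAl : forall (l : R[i]) (a b : A),
    l *: cstar_mul a b = cstar_mul (l *: a) b ;
  cstar_scaleAr : forall (l : R[i]) (a b : A),
    l *: cstar_mul a b = cstar_mul a (l *: b) ;
  cstar_normM : forall a b : A, `|cstar_mul a b| <= `|a| * `|b| ;
  star : A -> A ;
  starK : involutive star ;
  starD : forall a b : A, star (a + b) = star a + star b ;
  starZ : forall (l : R[i]) (a : A), star (l *: a) = Num.conj l *: star a ;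
  starM : forall a b : A, star (cstar_mul a b) = cstar_mul (star b) (star a) ;
  cstar_norm : forall a : A, `|cstar_mul (star a) a| = `|a| ^+ 2
}.

#[short(type="unitalCStarAlgType")]
HB.structure Definition UnitalCStarAlgebra (R : realType) :=
  {A of CompleteNormedModule R[i] A & isUnitalCStarAlgebra R A}.

Section cstar_ring.
Variables (R : realType) (A : unitalCStarAlgType R).
#[non_forgetful_inheritance]
HB.instance Definition _ := GRing.Zmodule_isPzRing.Build
  (UnitalCStarAlgebra.sort A) (@cstar_mulA R A) (@cstar_mul1r R A)
  (@cstar_mulr1 R A) (@cstar_mulDl R A) (@cstar_mulDr R A).
End cstar_ring.

Definition invertible (B : pzRingType) (a : B) : Prop :=
  exists b : B, b * a = 1 /\ a * b = 1.

Definition spectrum (R : realType) (A : unitalCStarAlgType R) (a : A)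
    : set R[i] :=
  [set l : R[i] | ~ invertible (a - l *: (1 : A))].

Definition cstar_positive (R : realType) (A : unitalCStarAlgType R) (a : A)
    : Prop :=
  star a = a /\ forall l : R[i], spectrum a l -> 0 <= l.

(* [act a x] is the module action [a x].  It is not rendered as an [lmodType A]
   since the carrier already is a module over the complex scalars. The norm of
   the carrier is the one of the inner product by [hdot_norm], and the carrier
   is complete for it as a [completeNormedModType]. *)
HB.mixin Record isHilbertModule (R : realType) (A : unitalCStarAlgType R) M
    of CompleteNormedModule R[i] M := {
  act : A -> M -> M ;
  actDl : forall (a b : A) (x : M), act (a + b) x = act a x + act b x ;
  actDr : forall (a : A) (x y : M), act a (x + y) = act a x + act a y ;
  actM : forall (a b : A) (x : M), act (a * b) x = act a (act b x) ;
  act1 : forall x : M, act 1 x = x ;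
  actZl : forall (l : R[i]) (a : A) (x : M), act (l *: a) x = l *: act a x ;
  actZr : forall (l : R[i]) (a : A) (x : M), act a (l *: x) = l *: act a x ;
  hdot : M -> M -> A ;
  hdot_ge0 : forall x : M, cstar_positive (hdot x x) ;
  hdot_eq0 : forall x : M, hdot x x = 0 -> x = 0 ;
  hdot_linear : forall (l : R[i]) (x y z : M),
    hdot (l *: x + y) z = l *: hdot x z + hdot y z ;
  hdot_act : forall (a : A) (x y : M), hdot (act a x) y = a * hdot x y ;
  hdot_star : forall x y : M, hdot x y = star (hdot y x) ;
  hdot_norm : forall x : M, `|x| = sqrtC `|hdot x x|
}.

#[short(type="hilbertModType")]
HB.structure Definition HilbertModule (R : realType)
    (A : unitalCStarAlgType R) :=
  {M of CompleteNormedModule R[i] M & isHilbertModule R A M}.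

Definition linear_span (R : realType) (V : lmodType R[i]) (S : set V) : set V :=
  [set v | exists (n : nat) (l : 'I_n -> R[i]) (s : 'I_n -> V),
     (forall i, S (s i)) /\ v = \sum_(i < n) l i *: s i].

Definition full (R : realType) (A : unitalCStarAlgType R)
    (M : hilbertModType A) : Prop :=
  closure (linear_span [set a : A | exists x y : M, a = hdot x y]) = [set: A].

Section endomorphisms.
Variables (R : realType) (A : unitalCStarAlgType R) (M : hilbertModType A).

Definition bounded_Alinear : {pred M -> M} :=
  [pred f : M -> M | `[< [/\ linear f,
     forall (a : A) (x : M), f (act a x) = act a (f x) &
     exists C : R[i], forall x : M, `|f x| <= C * `|x|] >]].

Record hmod_end := HmodEnd {
  hmod_end_fun :> M -> M ;
  _ : hmod_end_fun \in bounded_Alinear }.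

HB.instance Definition _ := [isSub for hmod_end_fun].
HB.instance Definition _ := gen_eqMixin hmod_end.
HB.instance Definition _ := gen_choiceMixin hmod_end.

Lemma hmod_endP (T S : hmod_end) : (forall x, T x = S x) -> T = S.
Proof. by move=> TS; apply: val_inj; apply/funext. Qed.

Lemma hmod_end_prop (T : hmod_end) : [/\ linear T,
  forall (a : A) (x : M), T (act a x) = act a (T x) &
  exists C : R[i], forall x : M, `|T x| <= C * `|x|].
Proof. by have /asboolP := valP T. Qed.

Let Re_normK (x : M) : (complex.Re `|x|)%:C = `|x|.
Proof. by rewrite RRe_real// normr_real. Qed.

Lemma act0 (a : A) : act a (0 : M) = 0.
Proof. by apply: (@addrI _ (act a (0 : M))); rewrite -actDr !addr0. Qed.

Lemma bounded_ge0 (f : M -> M) : (exists C : R[i], forall x, `|f x| <= C * `|x|) ->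
  exists2 C : R[i], 0 <= C & forall x, `|f x| <= C * `|x|.
Proof.
case=> C fC; exists `|C| => // x; apply: le_trans (fC x) _.
have := le_trans (normr_ge0 _) (fC x) => /ger0_norm <-.
by rewrite normrM normr_id.
Qed.

Lemma bounded_Alinear_submod : submod_closed bounded_Alinear.
Proof.
split.
  apply/asboolP; split.
  - by move=> l x y /=; rewrite scaler0 addr0.
  - by move=> a x /=; rewrite act0.
  - by exists 0 => x; rewrite normr0 mul0r.
move=> l f g /asboolP[f1 f2 f3] /asboolP[g1 g2 g3].
have E x : (l *: f + g) x = l *: f x + g x by [].
apply/asboolP; split.
- move=> k x y; rewrite !E f1 g1 !scalerDr !scalerA [k * l]mulrC -!addrA.
  by congr (_ + _); rewrite addrCA.
- by move=> a x; rewrite !E f2 g2 actDr actZr.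
have [C C0 fC] := bounded_ge0 f3; have [D D0 gD] := bounded_ge0 g3.
exists (`|l| * C + D) => x; rewrite E (le_trans (ler_normD _ _))//.
by rewrite mulrDl lerD// normrZ -mulrA ler_wpM2l.
Qed.

HB.instance Definition _ :=
  GRing.isSubmodClosed.Build R[i] (M -> M) bounded_Alinear bounded_Alinear_submod.

HB.instance Definition _ := [SubChoice_isSubLmodule of hmod_end by <:].

Lemma hmod_id_subproof : idfun \in bounded_Alinear.
Proof.
apply/asboolP; split => //.
by exists 1 => x; rewrite mul1r.
Qed.

Lemma hmod_comp_subproof (T S : hmod_end) : (T \o S) \in bounded_Alinear.
Proof.
apply/asboolP.
have [T1 T2 T3] := hmod_end_prop T; have [S1 S2 S3] := hmod_end_prop S.
split.
- by move=> l x y /=; rewrite S1 T1.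
- by move=> a x /=; rewrite S2 T2.
have [C C0 TC] := bounded_ge0 T3; have [D D0 SD] := bounded_ge0 S3.
exists (C * D) => x /=; apply: le_trans (TC _) _.
by rewrite -mulrA ler_wpM2l.
Qed.

Definition hmod_id := HmodEnd hmod_id_subproof.
Definition hmod_comp (T S : hmod_end) := HmodEnd (hmod_comp_subproof T S).

Let hmod_compA : associative hmod_comp.
Proof. by move=> T S U; apply: hmod_endP. Qed.
Let hmod_comp1l : left_id hmod_id hmod_comp.
Proof. by move=> T; apply: hmod_endP. Qed.
Let hmod_comp1r : right_id hmod_id hmod_comp.
Proof. by move=> T; apply: hmod_endP. Qed.
Let hmod_compDl : left_distributive hmod_comp +%R.
Proof. by move=> T S U; apply: hmod_endP. Qed.
Let hmod_compDr : right_distributive hmod_comp +%R.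
Proof.
move=> T S U; apply: hmod_endP => x; have [T1 _ _] := hmod_end_prop T.
by have := T1 1 (S x) (U x); rewrite !scale1r.
Qed.

HB.instance Definition _ := GRing.Zmodule_isPzRing.Build hmod_end
  hmod_compA hmod_comp1l hmod_comp1r hmod_compDl hmod_compDr.

(* The supremum of the norms [`|T x|] over the unit ball, taken in [R]. *)
Definition opnorm (T : hmod_end) : R[i] :=
  (sup [set complex.Re `|T x| | x in [set x : M | `|x| <= 1]])%:C.

Lemma opnorm_le (T : hmod_end) (C : R[i]) :
  (forall x : M, `|x| <= 1 -> `|T x| <= C) -> opnorm T <= C.
Proof.
move=> TC; have C0 : 0 <= C.
  by apply: le_trans (TC 0 _); rewrite ?normr_ge0// normr0 ler01.
rewrite -[C]RRe_real ?ger0_real// lecR; apply: ge_sup.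
  by exists (complex.Re `|T 0|), 0 => //=; rewrite normr0 ler01.
move=> _ [x x1 <-]; rewrite -lecR Re_normK RRe_real ?ger0_real//.
exact: TC.
Qed.

Lemma opnorm_ub (T : hmod_end) (x : M) : `|x| <= 1 -> `|T x| <= opnorm T.
Proof.
move=> x1; rewrite -[leLHS]Re_normK lecR.
have [_ _ /bounded_ge0[C C0 TC]] := hmod_end_prop T.
apply: ub_le_sup; last by exists x.
exists (complex.Re C) => _ [y y1 <-].
rewrite -lecR Re_normK RRe_real ?ger0_real//.
by apply: le_trans (TC y) _; rewrite ler_piMr.
Qed.

Lemma opnorm_ge0 (T : hmod_end) : 0 <= opnorm T.
Proof.
by apply: le_trans (opnorm_ub T (x := 0) _); rewrite ?normr_ge0// normr0 ler01.
Qed.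

Lemma opnormP (T : hmod_end) (x : M) : `|T x| <= opnorm T * `|x|.
Proof.
have [T1 _ _] := hmod_end_prop T.
have TZ (l : R[i]) (y : M) : T (l *: y) = l *: T y.
  have T0 : T 0 = 0.
    by have := T1 1 0 0; rewrite !scale1r addr0 => /esym/eqP;
      rewrite -subr_eq0 addrK => /eqP.
  by have := T1 l y 0; rewrite addr0 T0 addr0.
have [->|x0] := eqVneq x 0; first by rewrite -(scale0r 0) TZ !scale0r !normr0 mulr0.
rewrite -ler_pdivrMr ?normr_gt0// mulrC.
have := @opnorm_ub T (`|x|^-1 *: x).
rewrite TZ !normrZ normfV normr_id; apply.
by rewrite mulVf// normr_eq0.
Qed.

Let opnormD (T S : hmod_end) : opnorm (T + S) <= opnorm T + opnorm S.
Proof.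
apply: opnorm_le => x x1; apply: le_trans (ler_normD (T x) (S x)) _.
by rewrite lerD// opnorm_ub.
Qed.

Let opnormZ_le (l : R[i]) (T : hmod_end) : opnorm (l *: T) <= `|l| * opnorm T.
Proof.
apply: opnorm_le => x x1; rewrite [X in `|X|](_ : _ = l *: T x)//.
by rewrite normrZ ler_wpM2l// opnorm_ub.
Qed.

Let opnorm_eq0 (T : hmod_end) : opnorm T = 0 -> T = 0.
Proof.
move=> T0; apply: hmod_endP => x; apply/eqP; rewrite -normr_le0.
by have := opnormP T x; rewrite T0 mul0r.
Qed.

Let opnormZ (l : R[i]) (T : hmod_end) : opnorm (l *: T) = `|l| * opnorm T.
Proof.
apply: le_anti; rewrite opnormZ_le/=.
have [->|l0] := eqVneq l 0; first by rewrite normr0 mul0r opnorm_ge0.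
rewrite -[in leLHS](scale1r T) -(mulVf l0) -scalerA -ler_pdivlMl ?normr_gt0//.
by apply: le_trans (opnormZ_le _ _) _; rewrite normfV.
Qed.

HB.instance Definition _ :=
  Lmodule_isNormed.Build R[i] hmod_end opnormD opnormZ opnorm_eq0.

Lemma hmod_normE (T : hmod_end) : `|T| = opnorm T. Proof. by []. Qed.

Lemma hmod_mulE (T S : hmod_end) (x : M) : (T * S) x = T (S x).
Proof. by []. Qed.

End endomorphisms.
Arguments hmod_end {R A} M.

Definition is_derivation (R : realType) (A : unitalCStarAlgType R)
    (M : hilbertModType A) (d : hmod_end M -> hmod_end M) : Prop :=
  linear d /\ forall S T : hmod_end M, d (S * T) = d S * T + S * d T.

(* Main.v *)
Require Import Defs.
From HB Require Import structures.
From mathcomp Require Import all_boot all_order all_algebra.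
From mathcomp Require Import all_classical all_reals all_analysis.
From mathcomp Require Import complex.
From mathcomp Require Import ring lra.

Set Implicit Arguments.
Unset Strict Implicit.
Unset Printing Implicit Defensive.

Import Order.TTheory GRing.Theory Num.Theory.
Import numFieldNormedType.Exports.
Local Open Scope classical_set_scope.
Local Open Scope ring_scope.
Local Open Scope complex_scope.

(* Multiplication by an element of [A] is central in [End_A(M)], so
   [a |-> <d(a) x, y>] is a derivation of [A], and every derivation of a
   commutative C*-algebra vanishes: it suffices to treat a unitary [u] with
   [c = d u <> 0].  There is a multiplicative seminorm [p] with [p c > 0], and a
   scalar [l], necessarily of modulus 1, with [p (u - l) = 0].  Then [1 - u / l]
   has a square root [s], as [|u / l| <= 1] (boundary case of the binomial series),
   and [p s = 0], so that [c = - l d (s ^ 2)] gives [p c = 0].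

   Hence [d] is [A]-linear.  Write [theta_{u,v} z = <z, v> u]; expanding
   [d (theta_{u,v} T theta_{x,y}) = <T x, v> d theta_{u,y}] by Leibniz bounds
   [<d(T) x, v> <z, y> u] by a multiple of [|T|].  By fullness the same holds for
   [<d(T) x, v>], and two applications of the uniform boundedness principle bound
   [d]. *)

(** * Real-valued norms *)

Section real_norm.
Variables (R : realType) (V : normedModType R[i]).
Implicit Types (x y : V) (l : R[i]).

(* The norm of [V] is valued in [R[i]]; this is the same number seen in [R]. *)
Definition rnorm x : R := complex.Re `|x|.

Lemma rnormC x : (rnorm x)%:C = `|x|.
Proof. by rewrite /rnorm RRe_real// normr_real. Qed.

Lemma rnorm_ge0 x : 0 <= rnorm x.
Proof. by rewrite -lecR rnormC normr_ge0. Qed.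

Lemma rnormD x y : rnorm (x + y) <= rnorm x + rnorm y.
Proof. by rewrite -lecR rmorphD/= !rnormC ler_normD. Qed.

Lemma rnormN x : rnorm (- x) = rnorm x.
Proof. by rewrite /rnorm normrN. Qed.

Lemma rnormB x y : rnorm (x - y) <= rnorm x + rnorm y.
Proof. by rewrite -(rnormN y) rnormD. Qed.

Lemma rdistC x y : rnorm (x - y) = rnorm (y - x).
Proof. by rewrite /rnorm distrC. Qed.

Lemma rnorm0 : rnorm 0 = 0.
Proof. by rewrite /rnorm normr0. Qed.

Lemma rnorm_eq0 x : rnorm x = 0 -> x = 0.
Proof. by move=> x0; apply/eqP; rewrite -normr_eq0 -rnormC x0. Qed.

Lemma rnorm_gt0 x : x != 0 -> 0 < rnorm x.
Proof.
by move=> x0; rewrite lt_def rnorm_ge0 andbT; apply: contra_neq x0 => /rnorm_eq0.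
Qed.

Lemma rnormZ l x : rnorm (l *: x) = complex.Re `|l| * rnorm x.
Proof.
apply: complexI; transitivity ((complex.Re `|l|)%:C * (rnorm x)%:C).
  by rewrite !rnormC normrZ RRe_real// normr_real.
by rewrite rmorphM.
Qed.

Lemma rnormZr (r : R) x : rnorm (r%:C *: x) = `|r| * rnorm x.
Proof. by rewrite rnormZ normc_def/= expr0n addr0 sqrtr_sqr. Qed.

Lemma rnorm_leP x (C : R) : reflect (rnorm x <= C) (`|x| <= C%:C).
Proof. by rewrite -rnormC lecR; exact: idP. Qed.

End real_norm.

(** * Convergence by comparison with a bounded real sequence *)

Section majorised_convergence.
Variables (R : realType) (V : completeNormedModType R[i]).

(** The increments telescope, and the bounded nondecreasing [t] converges, so [u] is Cauchy. Having
    two consecutive terms near [l] allows a recursion for [u] to be passed to the limit. *)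
Lemma majorised_cvg (u : nat -> V) (t : nat -> R) (B : R) :
  (forall n, t n <= B) ->
  (forall n, rnorm (u n.+1 - u n) <= t n.+1 - t n) ->
  exists l : V, (forall n, rnorm (l - u n) <= B - t n) /\
    forall e, 0 < e -> exists n, rnorm (l - u n) < e /\ rnorm (l - u n.+1) < e.
Proof.
move=> tB ut.
have utm n k : rnorm (u (k + n)%N - u n) <= t (k + n)%N - t n.
  elim: k => [|k IH]; first by rewrite add0n !subrr rnorm0.
  rewrite addSn -(subrK (u (k + n)%N) (u _.+1)) -addrA.
  by rewrite (le_trans (rnormD _ _))//; have := ut (k + n)%N; move: IH; lra.
have ndt : nondecreasing_seq t.
  apply/nondecreasing_seqP => n.
  by rewrite -subr_ge0; apply: le_trans (ut n); exact: rnorm_ge0.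
have ubt : has_ubound (range t) by exists B => _ [n _ <-].
have ct : cvgn t by exact: nondecreasing_is_cvgn.
have cu : cvgn u.
  apply/cauchy_cvgP/cauchyP => e e0.
  have eC : e = (complex.Re e)%:C by rewrite RRe_real// ger0_real// ltW.
  have e0' : 0 < complex.Re e by rewrite -ltcR -eC.
  have /cvgrPdist_lt/(_ _ e0')[N _ Nt] := ct.
  exists (u N); exists N => // n /= Nn; rewrite -ball_normE /=.
  rewrite eC -rnormC ltcR rdistC -(subnK Nn).
  apply: le_lt_trans (utm _ _) _; rewrite subnK//.
  have := Nt N (leqnn N); have := nondecreasing_cvgn_le ndt ct n => /= h.
  rewrite ger0_norm; last by rewrite subr_ge0; exact: nondecreasing_cvgn_le.
  lra.
exists (limn u).
have lu e : 0 < e -> exists N, forall n, (N <= n)%N -> rnorm (limn u - u n) < e.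
  move=> e0; have e0' : 0 < e%:C by rewrite ltcR.
  have /cvgrPdist_lt/(_ _ e0')[N _ Nu] := cu.
  by exists N => n /Nu/=; rewrite -rnormC ltcR.
split=> [n|e e0]; last first.
  by have [N uN] := lu e e0; exists N; split; apply: uN.
apply/ler_addgt0Pr => e e0; have [N uN] := lu e e0.
have := uN (N + n)%N (leq_addr _ _); have := utm n N; have := tB (N + n)%N.
have := rnormD (limn u - u (N + n)%N) (u (N + n)%N - u n).
by rewrite addrA subrK; lra.
Qed.

End majorised_convergence.

(** * Infima of families of reals *)

Section family_infimum.
Variables (R : realType) (I : Type) (i0 : I).
Implicit Types (f : I -> R) (m b : R).

Lemma le_inf_range f m : (forall i, m <= f i) -> m <= inf (range f).
Proof.
by move=> mf; apply: lb_le_inf; [exists (f i0), i0|move=> _ [i _ <-]].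
Qed.

Lemma inf_range_le f i : (forall i, 0 <= f i) -> inf (range f) <= f i.
Proof.
by move=> f0; apply: ge_inf; [exists 0 => _ [j _ <-]|exists i].
Qed.

Lemma le_inf_rangeM f m b : 0 <= b -> (forall i, m <= f i * b) ->
  m <= inf (range f) * b.
Proof.
rewrite le_eqVlt => /predU1P[<-|b0] mf.
  by have := mf i0; rewrite !mulr0.
rewrite -ler_pdivrMr//; apply: le_inf_range => i.
by rewrite ler_pdivrMr.
Qed.

End family_infimum.

(** * Norm identities in a C*-algebra and seminorms compatible with squares *)

Section commutative_cstar.
Variables (R : realType) (A : unitalCStarAlgType R).
Implicit Types (x y z a : A) (l : R[i]).

Lemma scale_mulAl l x y : l *: (x * y) = (l *: x) * y.
Proof. exact: cstar_scaleAl. Qed.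

Lemma scale_mulAr l x y : l *: (x * y) = x * (l *: y).
Proof. exact: cstar_scaleAr. Qed.

Lemma rnorm_mul x y : rnorm (x * y) <= rnorm x * rnorm y.
Proof.
rewrite -lecR; have -> : (rnorm x * rnorm y)%:C = `|x| * `|y|.
  by rewrite -!rnormC rmorphM.
by rewrite rnormC; exact: cstar_normM.
Qed.

Lemma rnorm_star_mul x : rnorm (star x * x) = rnorm x ^+ 2.
Proof.
apply: complexI; rewrite rnormC.
transitivity ((rnorm x)%:C ^+ 2); first by rewrite rnormC; exact: cstar_norm.
by rewrite rmorphXn.
Qed.

Lemma star1 : star (1 : A) = 1.
Proof.
have := starM (star (1 : A)) 1.
by rewrite cstar_mulr1 starK cstar_mulr1 => <-.
Qed.

Lemma rnorm_le_star x : rnorm x <= rnorm (star x).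
Proof.
have := rnorm_ge0 x; rewrite le_eqVlt => /predU1P[<-|x0]; first exact: rnorm_ge0.
rewrite -(ler_pM2r x0); apply: le_trans (rnorm_mul _ _).
by rewrite rnorm_star_mul expr2.
Qed.

Lemma rnorm_star x : rnorm (star x) = rnorm x.
Proof.
by apply: le_anti; rewrite rnorm_le_star -{2}(starK x) rnorm_le_star.
Qed.

(** Equality fails in the zero algebra, which is allowed. *)
Lemma rnorm1_le1 : rnorm (1 : A) <= 1.
Proof.
have := rnorm_ge0 (1 : A); rewrite le_eqVlt => /predU1P[<-//|n0].
have := rnorm_star_mul 1; rewrite star1 mulr1 expr2 => e.
by rewrite -(ler_pM2r n0) mul1r -e.
Qed.

(* These functions turn out to be the suprema of [|chi x|] over sets of
   characters [chi] of [A]; the minimal ones are absolute values of characters. *)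
Record sq_seminorm (p : A -> R) : Prop := SqSeminorm {
  ssn_ge0 : forall x, 0 <= p x ;
  ssnD : forall x y, p (x + y) <= p x + p y ;
  ssnZ : forall l x, p (l *: x) <= complex.Re `|l| * p x ;
  ssnM : forall x y, p (x * y) <= p x * p y ;
  ssn_sqr : forall x, p x ^+ 2 <= p (x ^+ 2) ;
  ssn_le : forall x, p x <= rnorm x }.

(** Serves both for chains in Zorn's lemma and for the family [p (x g ^ n) / p g ^ n]. Directedness
    lets one index replace two; the product and square axioms are needed only up to a change of
    index. *)
Lemma inf_sq_seminorm (I : Type) (i0 : I) (F : I -> A -> R) :
  (forall i x, 0 <= F i x) ->
  (forall i j, exists k, forall x, F k x <= F i x /\ F k x <= F j x) ->
  (forall i x y, F i (x + y) <= F i x + F i y) ->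
  (forall i l x, F i (l *: x) <= complex.Re `|l| * F i x) ->
  (forall i, exists j, forall x y, F j (x * y) <= F i x * F i y) ->
  (forall i, exists j, forall x, F j x ^+ 2 <= F i (x ^+ 2)) ->
  (forall i x, F i x <= rnorm x) ->
  sq_seminorm (fun x => inf (range (F^~ x))).
Proof.
move=> F0 Fdir FD FZ FM Fsq Fle.
have infF i x : inf (range (F^~ x)) <= F i x by exact: inf_range_le.
split=> [x|x y|l x|x y|x|x].
- exact: le_inf_range.
- rewrite -lerBlDr; apply: le_inf_range => // i; rewrite lerBlDr -lerBlDl.
  apply: le_inf_range => // j; have [k kij] := Fdir i j.
  have := FD k x y; have [] := kij x; have [] := kij y.
  by have := infF k (x + y); lra.
- rewrite mulrC; apply: le_inf_rangeM => //.
    by rewrite -lecR RRe_real ?normr_real// normr_ge0.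
  by move=> i; rewrite mulrC; apply: le_trans (infF i _) _.
- have ix0 : 0 <= inf (range (F^~ y)) by exact: le_inf_range.
  apply: le_inf_rangeM => // i; rewrite mulrC; apply: le_inf_rangeM => // j.
  have [k kij] := Fdir i j; have [m mk] := FM k.
  apply: le_trans (infF m _) _; apply: le_trans (mk _ _) _.
  by rewrite mulrC ler_pM// ?(proj1 (kij _)) ?(proj2 (kij _)).
- apply: le_inf_range => // i; have [j ji] := Fsq i.
  by apply: le_trans (ji x); rewrite lerXn2r// nnegrE// le_inf_range.
- by apply: le_trans (infF i0 _) _.
Qed.

Section one_seminorm.
Variables (p : A -> R) (pS : sq_seminorm p).

Lemma ssn_mulX x y n : p (x * y ^+ n) <= p x * p y ^+ n.
Proof.
elim: n => [|n IH]; first by rewrite !expr0 !mulr1.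
rewrite !exprSr !mulrA; apply: le_trans (ssnM pS _ _) _.
by rewrite ler_wpM2r// ssn_ge0.
Qed.

(** Repeated squaring gives the exponents [2 ^ k]. In general write [2 ^ n = n + m]: then
    [p x ^ n * p x ^ m <= p (x ^ n) * p x ^ m], and the positive [p x ^ m] cancels. *)
Lemma ssnX x n : 0 < p x -> p x ^+ n <= p (x ^+ n).
Proof.
move=> x0; have p2 k : p x ^+ (2 ^ k) <= p (x ^+ (2 ^ k)).
  elim: k => [|k IH]; first by rewrite expn0 !expr1.
  rewrite expnSr !exprM; apply: le_trans (ssn_sqr pS _).
  by rewrite lerXn2r// nnegrE ?exprn_ge0 ?ssn_ge0.
have n2 : (n <= 2 ^ n)%N by rewrite ltnW// ltn_expl.
have := p2 n; rewrite -(subnKC n2) !exprD => h.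
have := le_trans h (ssn_mulX _ _ _).
by rewrite ler_pM2r// exprn_gt0.
Qed.

Lemma ssnN x : p (- x) = p x.
Proof.
have le y : p (- y) <= p y.
  by rewrite -scaleN1r; apply: le_trans (ssnZ pS _ _) _; rewrite normrN1 mul1r.
by apply: le_anti; rewrite le -{1}(opprK x) le.
Qed.

Lemma ssnB x y : p (x - y) <= p x + p y.
Proof. by rewrite -(ssnN y) ssnD. Qed.

Lemma ssn_distC x y : p (x - y) = p (y - x).
Proof. by rewrite -ssnN opprB. Qed.

End one_seminorm.

End commutative_cstar.

(** * Existence of multiplicative seminorms *)

Section multiplicative_seminorm.
Variables (R : realType) (A : unitalCStarAlgType R).
Hypothesis A_comm : commutative (fun a b : A => a * b).
Implicit Types (x y z a c g : A) (l : R[i]).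

Lemma comm_mulrACA x y z a : (x * y) * (z * a) = (x * z) * (y * a).
Proof. by rewrite !mulrA -(mulrA x y z) (A_comm y z) mulrA. Qed.

Lemma comm_exprMn x y n : (x * y) ^+ n = x ^+ n * y ^+ n.
Proof. by apply: exprMn_comm; exact: A_comm. Qed.

(** By commutativity [star (x ^ 2) * x ^ 2 = star h * h] with [h = star x * x], so the C*-identity
    gives [|x ^ 2| ^ 2 = |x| ^ 4]. *)
Lemma rnorm_sqr x : rnorm (x ^+ 2) = rnorm x ^+ 2.
Proof.
have h : rnorm (x ^+ 2) ^+ 2 = (rnorm x ^+ 2) ^+ 2.
  rewrite -!rnorm_star_mul; congr rnorm.
  rewrite !expr2 !(starM : forall a b : A, star (a * b) = star b * star a) starK.
  exact: comm_mulrACA.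
by apply/eqP; rewrite -(@eqrXn2 _ 2)// ?h ?exprn_ge0 ?rnorm_ge0.
Qed.

Lemma rnorm_ssn : sq_seminorm (@rnorm R A).
Proof.
split=> *; rewrite ?rnorm_ge0 ?rnormD ?rnormZ ?rnorm_mul ?rnorm_sqr//.
Qed.

(** Zorn's lemma: infima of nonempty chains stay in the class. The condition at [c] keeps the
    minimal seminorm from vanishing at a nonzero [c]. *)
Lemma minimal_ssn c : exists p : A -> R, [/\ sq_seminorm p, rnorm c <= p c &
  forall q, sq_seminorm q -> rnorm c <= q c -> (forall x, q x <= p x) ->
  forall x, p x <= q x].
Proof.
pose T := {p : A -> R | sq_seminorm p /\ rnorm c <= p c}.
pose t0 : T := exist _ (@rnorm R A) (conj rnorm_ssn (lexx _)).
(* The order is reversed, so that maximal elements are minimal seminorms. *)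
pose le_T (s t : T) := `[< forall x, sval t x <= sval s x >].
have [||C totC|p pmin] := @ZL_preorder T t0 le_T.
- by move=> s; apply/asboolP.
- move=> r s t /asboolP rs /asboolP st; apply/asboolP => x.
  exact: le_trans (st x) (rs x).
- have [[s0 Cs0]|C0] := pselect (exists s, C s); last first.
    by exists t0 => s Cs; case: C0; exists s.
  pose I := {s | C s}; pose F (i : I) : A -> R := sval (sval i).
  pose i0 : I := exist _ s0 Cs0.
  have FS i : sq_seminorm (F i) by case: (svalP (sval i)).
  pose q x := inf (range (F^~ x)).
  have qS : sq_seminorm q.
    apply: (inf_sq_seminorm i0) => [i x|i j|i|i|i|i|i x].
    + exact: ssn_ge0.
    + have [/asboolP ij|/asboolP ji] := totC _ _ (svalP i) (svalP j).
        by exists j => x; split => //; exact: ij.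
      by exists i => x; split => //; exact: ji.
    + exact: ssnD.
    + exact: ssnZ.
    + by exists i; exact: ssnM.
    + by exists i; exact: ssn_sqr.
    + exact: ssn_le.
  have qc : rnorm c <= q c.
    by apply: (le_inf_range i0) => i; case: (svalP (sval i)).
  exists (exist _ q (conj qS qc)) => s Cs; apply/asboolP => x /=.
  apply: (@inf_range_le _ I (F^~ x) (exist _ s Cs)) => i; exact: ssn_ge0.
case: p pmin => p [pS pc] pmin; exists p; split => // q qS qc qp.
by apply/asboolP/(pmin (exist _ q (conj qS qc)))/asboolP.
Qed.

(* Minimality forces [p] to coincide with the smaller seminorm
   [inf_n p (x g^n) / p g ^ n]. *)
Lemma minimal_ssn_mul c p g : sq_seminorm p ->
  (forall q, sq_seminorm q -> rnorm c <= q c -> (forall x, q x <= p x) ->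
    forall x, p x <= q x) ->
  0 < p g -> (forall n, rnorm c * p g ^+ n <= p (c * g ^+ n)) ->
  forall x, p x * p g <= p (x * g).
Proof.
move=> pS pmin g0 cg x.
pose F n x := p (x * g ^+ n) / p g ^+ n.
have gn0 n : 0 < p g ^+ n by rewrite exprn_gt0.
have F0 n y : 0 <= F n y by rewrite /F divr_ge0 ?ssn_ge0// ltW.
(* [F] decreases in its index, which makes the family directed. *)
have FleD n k y : F (n + k)%N y <= F n y.
  rewrite /F ler_pdivrMr// exprD mulrA; apply: le_trans (ssn_mulX pS _ _ _) _.
  by rewrite exprD mulrA divfK// gt_eqF.
have FM n y z : F (n + n)%N (y * z) <= F n y * F n z.
  rewrite /F !exprD comm_mulrACA invfM mulrACA ler_wpM2r ?ssnM//.
  by rewrite mulr_ge0 ?invr_ge0 ?ltW.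
have Fle n y : F n y <= p y.
  have := FleD 0%N n y; rewrite add0n => /le_trans; apply.
  by rewrite /F !expr0 divr1 mulr1.
pose q x := inf (range (F^~ x)).
have qS : sq_seminorm q.
  apply: (inf_sq_seminorm 0%N) => [//|i j|i y z|i l y|i|i|i y].
  - by exists (i + j)%N => y; rewrite FleD addnC FleD.
  - by rewrite /F -mulrDl ler_pM2r ?invr_gt0// mulrDl ssnD.
  - by rewrite /F mulrA ler_pM2r ?invr_gt0// -scale_mulAl ssnZ.
  - by exists (i + i)%N => y z; exact: FM.
  - exists i => y; apply: le_trans (FleD i i _).
    rewrite /F exprMn exprVn -exprM mulnC mul2n addnn.
    rewrite ler_pM2r ?invr_gt0//; apply: le_trans (ssn_sqr pS _) _.
    by rewrite comm_exprMn -exprM muln2.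
  - exact: le_trans (Fle _ _) (ssn_le pS _).
have qc : rnorm c <= q c.
  by apply: (le_inf_range 0%N) => n; rewrite /F ler_pdivlMr.
have qp y : q y <= p y.
  by apply: le_trans (Fle 0%N y); apply: (@inf_range_le _ nat (F^~ y)).
rewrite -ler_pdivlMr//; apply: le_trans (pmin q qS qc qp x) _.
have -> : p (x * g) / p g = F 1%N x by rewrite /F !expr1.
exact: (@inf_range_le _ nat (F^~ x)).
Qed.

(** Minimality is exploited twice. With [g = c] it gives [p x * p c <= p (x * c)]; this in turn
    supplies the lower bound on [p (c * y ^ n)] needed to take [g = y] for any [y] with
    [p y > 0]. *)
Lemma mult_ssn c : c != 0 -> exists p : A -> R, [/\ sq_seminorm p, 0 < p c &
  forall x y, p (x * y) = p x * p y].
Proof.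
move=> /rnorm_gt0 c0; have [p [pS pc pmin]] := minimal_ssn c.
have pc0 : 0 < p c := lt_le_trans c0 pc.
have pcM x : p x * p c <= p (x * c).
  apply: (minimal_ssn_mul pS pmin pc0) => n.
  apply: le_trans (_ : p c * p c ^+ n <= _); first by rewrite ler_wpM2r ?exprn_ge0// ltW.
  by rewrite -!exprS ssnX.
exists p; split => // x y; apply: le_anti; rewrite ssnM//=.
have [->|y0] := eqVneq (p y) 0; first by rewrite mulr0 ssn_ge0.
have {}y0 : 0 < p y by rewrite lt_def y0 ssn_ge0.
apply: (minimal_ssn_mul pS pmin y0) => n; rewrite A_comm.
apply: le_trans (pcM _); rewrite mulrC ler_pM ?exprn_ge0 ?rnorm_ge0 ?ssn_ge0//.
exact: ssnX.
Qed.

End multiplicative_seminorm.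

(** * A Gelfand-Mazur theorem for multiplicative seminorms *)

Section gelfand_mazur.
Variables (R : realType) (A : unitalCStarAlgType R).
Variables (p : A -> R) (pS : sq_seminorm p).
Hypotheses (p1 : p 1 = 1) (pM : forall x y, p (x * y) = p x * p y).
Implicit Types (x y a b : A) (l z e : R[i]).
Local Notation one := (1 : A).

Lemma mssnX x n : p (x ^+ n) = p x ^+ n.
Proof. by elim: n => [|n IH]; rewrite ?expr0// !exprS pM IH. Qed.

Lemma mssnZ1 l : p (l *: one) = complex.Re `|l|.
Proof.
have h z : p (z *: one) <= complex.Re `|z|.
  by apply: le_trans (ssnZ pS _ _) _; rewrite p1 mulr1.
have [->|l0] := eqVneq l 0.
  by apply: le_anti; rewrite h normr0 andTb; exact: ssn_ge0.
apply: le_anti; rewrite h andTb.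
have n0 : 0 < complex.Re `|l| by rewrite -ltcR RRe_real ?normr_real// normr_gt0.
have : p (l *: one) * p (l^-1 *: one) = 1.
  by rewrite -pM -scale_mulAl mul1r scalerA divff// scale1r.
move=> e1; have := ler_wpM2l (ssn_ge0 pS (l *: one)) (h l^-1).
have -> : complex.Re `|l^-1| = (complex.Re `|l|)^-1.
  apply: complexI; transitivity ((complex.Re `|l|)%:C^-1); last by rewrite fmorphV.
  by rewrite !RRe_real ?normr_real// normfV.
by rewrite e1 ler_pdivlMr// mul1r.
Qed.

Lemma diff_scalar_sqr a l : a ^+ 2 - l ^+ 2 *: one = (a - l *: one) * (a + l *: one).
Proof.
have al : a * (l *: one) = l *: a by rewrite -scale_mulAr mulr1.
have la : l *: one * a = l *: a by rewrite -scale_mulAl mul1r.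
have ll : l *: one * (l *: one) = l ^+ 2 *: one.
  by rewrite -scale_mulAl mul1r scalerA.
by rewrite mulrDr !mulrBl al la ll expr2 addrA subrK.
Qed.

Section local_constancy.
Variables (a : A) (r : R).
Hypotheses (r0 : 0 < r) (r_min : forall l, r <= p (a - l *: one)).

(** Repeated square roots of the scalar split the element into [2 ^ k] factors [a - z], on each of
    which [p] is at least [r]. *)
Lemma min_power l k : r ^+ (2 ^ k) <= p (a ^+ (2 ^ k) - l *: one).
Proof.
elim: k l => [|k IH] l; first by rewrite !expr1 r_min.
rewrite expnSr !exprM -(sqr_sqrtc l) diff_scalar_sqr pM expr2.
have := IH (- sqrtc l); rewrite scaleNr opprK => h.
by apply: ler_pM => //; rewrite exprn_ge0// ltW.
Qed.

(** One of the [2 ^ k] linear factors of [a ^ (2 ^ k) - l ^ (2 ^ k)] is [a - l]; the others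
    contribute at least [r ^ (2 ^ k - 1)]. The extra [r] avoids the subtraction in the exponent. *)
Lemma min_factor l k :
  p (a - l *: one) * r ^+ (2 ^ k) <= p (a ^+ (2 ^ k) - l ^+ (2 ^ k) *: one) * r.
Proof.
elim: k => [|k IH]; first by rewrite !expr1.
rewrite expnSr !exprM diff_scalar_sqr pM expr2 mulrA [leRHS]mulrAC.
apply: ler_pM => //; rewrite ?mulr_ge0 ?exprn_ge0 ?ssn_ge0 ?(ltW r0)//.
by have := min_power (- l ^+ (2 ^ k)) k; rewrite scaleNr opprK.
Qed.

(** With [n = 2 ^ k], the triangle inequality bounds [p (a ^ n - (r / 2) ^ n)] by
    [r ^ n + (r / 2) ^ n]. Factoring then yields [p (a - r / 2) <= r + r / 2 ^ n], and [n] is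
    arbitrarily large. *)
Lemma min_shift : p a = r -> p (a - (r / 2)%:C *: one) = r.
Proof.
move=> par; apply: le_anti; rewrite r_min andbT.
have r2 : 0 <= r / 2 by rewrite divr_ge0// ltW.
have bnd k : p (a - (r / 2)%:C *: one) <= r + r / 2 ^+ (2 ^ k).
  have := min_factor (r / 2)%:C k; set n := (2 ^ k)%N => h.
  have : p (a ^+ n - (r / 2)%:C ^+ n *: one) <= r ^+ n + (r / 2) ^+ n.
    apply: le_trans (ssnB pS _ _) _; rewrite mssnX par lerD2l mssnZ1.
    by rewrite -rmorphXn ger0_norm// ler0c exprn_ge0.
  rewrite expr_div_n => h2.
  have rn : 0 < r ^+ n by rewrite exprn_gt0.
  rewrite -(ler_pM2r rn); apply: le_trans h _.
  apply: le_trans (ler_wpM2r (ltW r0) h2) _.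
  by rewrite le_eqVlt; apply/orP; left; apply/eqP; ring.
rewrite leNgt; apply/negP; rewrite -subr_gt0; set d := _ - r => d0.
pose N := Num.bound (r / d).
have : r / d < N%:R by rewrite archi_boundP// divr_ge0// ltW.
rewrite ltr_pdivrMr// => rN.
have N2 : N%:R <= 2 ^+ (2 ^ N) :> R.
  rewrite -natrX ler_nat; apply: leq_trans (ltnW (ltn_expl N (ltnSn 1))) _.
  by rewrite leq_exp2l// ltnW// ltn_expl.
have := bnd N; rewrite -lerBlDl -/d ler_pdivlMr ?exprn_gt0// mulrC.
by apply/negP; rewrite -ltNge; apply: lt_le_trans rN _; rewrite ler_pM2r.
Qed.

End local_constancy.

(** Real coordinates are used so that a minimum can be found on a compact square of [R * R]. *)
Lemma ssn_scalar_continuous a :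
  continuous (fun v : R * R => p (a - (v.1 +i* v.2) *: one)).
Proof.
move=> v; apply/cvgrPdist_le => e e0.
have e2 : 0 < e / 2 by rewrite divr_gt0.
exists (ball v.1 (e / 2), ball v.2 (e / 2)).
  by split; exact: nbhsx_ballx.
move=> w [/= /ltW b1 /ltW b2].
have dist x y : `|p x - p y| <= p (x - y).
  rewrite ler_norml; apply/andP; split; last first.
    by rewrite lerBlDr; have := ssnD pS (x - y) y; rewrite subrK.
  rewrite lerBrDl lerBlDr; have := ssnD pS (y - x) x; rewrite subrK.
  by rewrite (ssn_distC pS) addrC.
apply: le_trans (dist _ _) _; rewrite opprB addrC addrA subrK -scalerBl mssnZ1.
have -> : w.1 +i* w.2 - (v.1 +i* v.2) = (w.1 - v.1)%:C + 'i%C * (w.2 - v.2)%:C.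
  by simpc.
apply: (@le_trans _ _ (complex.Re (`|(w.1 - v.1)%:C| + `|'i%C * (w.2 - v.2)%:C|))).
  by rewrite -lecR !RRe_real ?normr_real ?rpredD ?normr_real// ler_normD.
rewrite normrM !normc_def/= !expr0n !expr1n/= !addr0 !add0r sqrtr1 !sqrtr_sqr mul1r.
by rewrite (splitr e) !mulr0 subr0 lerD// distrC.
Qed.

Lemma ssn_min a : exists l, forall z, p (a - l *: one) <= p (a - z *: one).
Proof.
(* If [|z| > B] then [p (a - z) >= |z| - p a > p a], which already exceeds the value at [z = 0]. *)
pose B := 2 * p a + 1; pose D := `[- B, B] `*` `[- B, B].
have pa0 := ssn_ge0 pS a.
have D0 : D (0, 0).
  by split; rewrite /= in_itv/=; apply/andP; split; rewrite /B; lra.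
have [||v vD vmin] := @compact_EVT_min _ R
    (fun v : R * R => p (a - (v.1 +i* v.2) *: one)) D _
    (compact_setX (@segment_compact R _ _) (@segment_compact R _ _)).
- by exists (0, 0).
- by apply: continuous_subspaceT; exact: ssn_scalar_continuous.
exists (v.1 +i* v.2) => z.
have p0 : p (a - (v.1 +i* v.2) *: one) <= p a.
  by have := vmin (0, 0) (mem_set D0); rewrite /= scale0r subr0.
have [zB|zB] := leP (complex.Re `|z|) B.
  have := vmin (complex.Re z, complex.Im z); rewrite /=.
  have -> : (complex.Re z +i* complex.Im z) = z by case: (z).
  apply; apply/mem_set; rewrite normc_def/= in zB.
  split; rewrite /= in_itv/= -ler_norml; apply: le_trans zB.
    by rewrite -sqrtr_sqr ler_wsqrtr// lerDl sqr_ge0.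
  by rewrite -sqrtr_sqr ler_wsqrtr// lerDr sqr_ge0.
apply: le_trans p0 _; rewrite -mssnZ1 in zB.
have := ssnB pS a (a - z *: one); rewrite opprB addrC subrK.
by move: zB; rewrite /B; lra.
Qed.

(* The infimum [r] of [p (a - l)] is attained.  If it were positive, then
   [p (a - l) = r] would propagate from any [l] to [l + r / 2], hence to points
   of large absolute value, where [p (a - l)] is large. *)
Lemma gelfand_mazur a : exists l, p (a - l *: one) = 0.
Proof.
have [l lmin] := ssn_min a; exists l; apply: contrapT => /eqP r_neq0.
set r := p (a - l *: one) in lmin r_neq0.
have r0 : 0 < r by rewrite lt_def r_neq0 ssn_ge0.
have shift k : p (a - (l + (k%:R * (r / 2))%:C) *: one) = r.
  elim: k => [|k IH]; first by rewrite mul0r addr0.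
  set b := a - _ *: one in IH.
  have := min_shift r0 _ IH.
  have -> : b - (r / 2)%:C *: one = a - (l + (k.+1%:R * (r / 2))%:C) *: one.
    rewrite /b -addrA -opprD -scalerDl -addrA -rmorphD/=.
    by rewrite -[k.+1]addn1 natrD mulrDl mul1r.
  by apply => z; rewrite /b -addrA -opprD -scalerDl.
(* Two scalars at which the value is [r] differ by at most [2 r], but five shifts cover
   [5 r / 2]. *)
have := ssnB pS (a - l *: one) (a - (l + (5%:R * (r / 2))%:C) *: one).
rewrite shift -/r opprB addrC addrA subrK scalerDl addrAC subrr add0r mssnZ1.
rewrite ger0_norm/=; last by rewrite ler0c mulr_ge0// divr_ge0// ltW.
by move: r0; lra.
Qed.

End gelfand_mazur.

(** * Square roots, and the vanishing of derivations of a commutative C*-algebra *)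

Section derivations.
Variables (R : realType) (A : unitalCStarAlgType R).
Hypothesis A_comm : commutative (fun a b : A => a * b).
Implicit Types (x y a b u w s : A) (l : R[i]).
Local Notation one := (1 : A).

Lemma conj_realC (r : R) : Num.conj r%:C = r%:C :> R[i].
Proof. by apply: conj_Creal; apply/complex_realP; exists r. Qed.

Lemma conj_iC : Num.conj 'i%C = - 'i%C :> R[i].
Proof. by rewrite complexiE conjCi. Qed.

Lemma starB x y : star (x - y) = star x - star y.
Proof. by rewrite starD -scaleN1r starZ rmorphN1 scaleN1r. Qed.

Lemma star_mul x y : star (x * y) = star y * star x.
Proof. exact: starM. Qed.

Lemma rnorm_small (V : normedModType R[i]) (x : V) :
  (forall e, 0 < e -> rnorm x <= e + e) -> x = 0.
Proof.
move=> h; apply: rnorm_eq0; apply: le_anti; rewrite rnorm_ge0 andbT.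
apply/ler_addgt0Pr => e e0; rewrite add0r (splitr e).
by apply: h; rewrite divr_gt0.
Qed.

Lemma comm_subr_sqr x y : x ^+ 2 - y ^+ 2 = (x - y) * (x + y).
Proof. by rewrite mulrDr !mulrBl (A_comm y x) addrA subrK. Qed.

(* [s = 1 - lim y_n] where [y_{n+1} = (w + y_n ^ 2) / 2]; the increments of
   [y_n] are dominated by those of the same sequence for [w = 1] in [R]. *)
Lemma sqrt_one_sub w : rnorm w <= 1 ->
  exists s, s ^+ 2 = one - w /\ (star w = w -> star s = s).
Proof.
move=> w1.
have [y [y0 yS]] : exists y : nat -> A,
    y 0%N = 0 /\ forall n, y n.+1 = (2^-1)%:C *: (w + y n ^+ 2).
  by exists (fix y n := if n is m.+1 then (2^-1)%:C *: (w + y m ^+ 2) else 0).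
have [t [t0 tS]] : exists t : nat -> R,
    t 0%N = 0 /\ forall n, t n.+1 = 2^-1 * (1 + t n ^+ 2).
  by exists (fix t n := if n is m.+1 then 2^-1 * (1 + t m ^+ 2) else 0).
have half0 : 0 <= 2^-1 :> R by rewrite invr_ge0.
have t01 n : 0 <= t n <= 1.
  elim: n => [|n IH]; first by rewrite t0 lexx ler01.
  by rewrite tS; apply/andP; split; nra.
have sqr_le x : rnorm (x ^+ 2) <= rnorm x ^+ 2 by rewrite !expr2 rnorm_mul.
have yt n : rnorm (y n) <= t n.
  elim: n => [|n IH]; first by rewrite y0 t0 rnorm0.
  rewrite yS tS rnormZr ger0_norm// ler_wpM2l//.
  apply: le_trans (rnormD _ _) _; apply: lerD => //.
  apply: le_trans (sqr_le _) _.
  by have := rnorm_ge0 (y n); have := t01 n; nra.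
have dy x z : rnorm ((2^-1)%:C *: (w + x ^+ 2) - (2^-1)%:C *: (w + z ^+ 2)) <=
    2^-1 * (rnorm (x - z) * (rnorm x + rnorm z)).
  rewrite -scalerBr opprD addrACA subrr add0r comm_subr_sqr.
  rewrite rnormZr ger0_norm// ler_wpM2l//.
  by apply: le_trans (rnorm_mul _ _) _; rewrite ler_wpM2l ?rnorm_ge0 ?rnormD.
have dyt n : rnorm (y n.+1 - y n) <= t n.+1 - t n.
  elim: n => [|n IH]; first by rewrite y0 t0 !subr0.
  rewrite (yS n) (yS n.+1); apply: le_trans (dy _ _) _.
  have -> : t n.+2 - t n.+1 = 2^-1 * ((t n.+1 - t n) * (t n.+1 + t n)).
    by rewrite (tS n.+1) {2}(tS n); ring.
  apply: ler_wpM2l => //; apply: ler_pM => //; rewrite ?addr_ge0 ?rnorm_ge0//.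
  exact: lerD.
have t1 n : t n <= 1 by case/andP: (t01 n).
have [l [ly ycvg]] := majorised_cvg t1 dyt.
have l1 : rnorm l <= 1 by have := ly 0%N; rewrite y0 t0 !subr0.
have lfix : l = (2^-1)%:C *: (w + l ^+ 2).
  apply/eqP; rewrite -subr_eq0; apply/eqP/rnorm_small => e /ycvg[n [e1 e2]].
  rewrite -[l in l - _](subrK (y n.+1)) -[X in rnorm X]addrA.
  apply: le_trans (rnormD _ _) _; apply: lerD; first exact: ltW.
  rewrite yS; apply: le_trans (dy _ _) _; rewrite rdistC.
  have := rnorm_ge0 (l - y n); have := yt n; have := t1 n.
  have := rnorm_ge0 (y n); have := rnorm_ge0 l; nra.
(* The fixed-point equation reads [2 l = w + l ^ 2], whence [(1 - l) ^ 2 = 1 - w]. *)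
exists (1 - l); split.
  have l2 : l + l = w + l ^+ 2.
    transitivity ((2 : R[i]) *: l); first by rewrite scaler_nat mulr2n.
    rewrite {1}lfix scalerA [X in X *: _](_ : _ = 1) ?scale1r//.
    by rewrite fmorphV rmorph_nat mulfV ?pnatr_eq0.
  rewrite expr2 mulrBl mul1r mulrBr mulr1 -expr2 opprB [l ^+ 2 - l]addrC.
  by rewrite addrA -[one - l - l]addrA -opprD l2 opprD addrA subrK.
move=> ww; rewrite starB star1; congr (_ - _).
have yy n : star (y n) = y n.
  elim: n => [|n IH]; first by have := starB 0 0; rewrite y0 !subrr.
  by rewrite yS starZ starD ww expr2 star_mul IH conj_realC.
apply/eqP; rewrite -subr_eq0; apply/eqP/rnorm_small => e /ycvg[n [/ltW e1 _]].
rewrite -(subrK (y n) (star l)) -addrA; apply: le_trans (rnormD _ _) _.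
apply: lerD; last by rewrite rdistC.
by rewrite -[y n in leLHS]yy -starB rnorm_star.
Qed.

Variable D : A -> A.
Hypotheses (D_linear : linear D)
  (D_mul : forall x y, D (x * y) = D x * y + x * D y).

Let DZD l x y : D (l *: x + y) = l *: D x + D y.
Proof. exact: D_linear. Qed.

Let DD x y : D (x + y) = D x + D y.
Proof. by have := DZD 1 x y; rewrite !scale1r. Qed.

Let D0 : D 0 = 0.
Proof. by apply: (@addrI _ (D 0)); rewrite -DD !addr0. Qed.

Let DZ l x : D (l *: x) = l *: D x.
Proof. by have := DZD l x 0; rewrite D0 !addr0. Qed.

Let D1 : D 1 = 0.
Proof.
have := D_mul 1 1; rewrite !mulr1 mul1r => h.
by apply: (@addrI _ (D 1)); rewrite -h addr0.
Qed.

Lemma derivation_unitary u : star u * u = 1 -> D u = 0.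
Proof.
move=> uu; apply: contrapT => /eqP/(mult_ssn A_comm)[p [pS pc pM]].
have p1 : p 1 = 1.
  by apply: (mulfI (lt0r_neq0 pc)); rewrite -pM !mulr1.
have u1 : rnorm u <= 1.
  have := rnorm_star_mul u; rewrite uu => h; have := rnorm1_le1 A.
  by rewrite h; have := rnorm_ge0 u; nra.
have [l l0] := gelfand_mazur pS p1 pM u.
(* Both [p u] and [p (star u)] are at most 1, and their product is 1. *)
have pu : p u = 1.
  have := pM (star u) u; rewrite uu p1.
  have := ssn_le pS u; have := ssn_le pS (star u); rewrite rnorm_star.
  by have := ssn_ge0 pS u; have := ssn_ge0 pS (star u); nra.
have l1 : complex.Re `|l| = 1.
  rewrite -(mssnZ1 pS p1 pM).
  have := ssnB pS u (u - l *: one); have := ssnD pS (u - l *: one) (l *: one).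
  by rewrite subrK subKr l0 pu; lra.
have nl : `|l| = 1 by rewrite -[LHS]RRe_real ?normr_real// l1.
have l_neq0 : l != 0 by rewrite -normr_eq0 nl oner_eq0.
have w1 : rnorm (l^-1 *: u) <= 1.
  by rewrite rnormZ normfV nl invr1 mul1r.
have [s [ss _]] := sqrt_one_sub w1.
have ps : p s = 0.
  apply/eqP; rewrite -sqrf_eq0 -(mssnX p1 pM) ss.
  have -> : one - l^-1 *: u = l^-1 *: (l *: one - u).
    by rewrite scalerBr scalerA mulVf// scale1r.
  rewrite eq_le ssn_ge0// andbT; apply: le_trans (ssnZ pS _ _) _.
  by rewrite (ssn_distC pS) l0 mulr0.
have Dss : D u = - l *: (D s * s + s * D s).
  rewrite -D_mul -expr2 ss DD D1 add0r -scaleNr DZ scalerA.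
  by rewrite mulrNN mulfV// scale1r.
move: pc; rewrite Dss; apply/negP; rewrite -leNgt.
apply: le_trans (ssnZ pS _ _) _; rewrite normrN l1 mul1r.
by apply: le_trans (ssnD pS _ _) _; rewrite !pM ps mulr0 mul0r addr0.
Qed.

(** After rescaling to [h] of norm at most 1, [2 h] is the sum of the unitaries [h + i s] and
    [h - i s], where [s] is a self-adjoint square root of [1 - h ^ 2]. *)
Lemma derivation_selfadjoint a : star a = a -> D a = 0.
Proof.
move=> aa; pose t := (rnorm a + 1)^-1.
have n0 : 0 < rnorm a + 1 by rewrite ltr_wpDl ?rnorm_ge0.
have t0 : 0 < t by rewrite invr_gt0.
pose h := t%:C *: a.
have hh : star h = h by rewrite starZ aa conj_realC.
have h1 : rnorm h <= 1.
  rewrite rnormZr gtr0_norm// mulrC ler_pdivrMr// mul1r lerDl//.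
have w1 : rnorm (h ^+ 2) <= 1.
  by rewrite rnorm_sqr//; have := rnorm_ge0 h; nra.
have [s [ss sstar]] := sqrt_one_sub w1.
have {}sstar : star s = s by apply: sstar; rewrite expr2 star_mul hh.
pose u := h + 'i%C *: s; pose v := h - 'i%C *: s.
have uv : star u = v.
  by rewrite starD hh starZ sstar conj_iC scaleNr.
have vu : star v = u by rewrite -uv starK.
have vmu : v * u = 1.
  have is2 : ('i%C *: s) ^+ 2 = - s ^+ 2.
    rewrite expr2 -scale_mulAl -scale_mulAr scalerA -!expr2.
    by rewrite sqr_i scaleN1r.
  by rewrite -comm_subr_sqr is2 opprK ss addrC subrK.
have Du : D u = 0 by apply: derivation_unitary; rewrite uv.
have Dv : D v = 0 by apply: derivation_unitary; rewrite vu -vmu; exact: A_comm.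
have : D (u + v) = 0 by rewrite DD Du Dv addr0.
rewrite /u /v addrACA subrr addr0 DD /h DZ -mulr2n -scaler_nat scalerA.
move/eqP; rewrite scaler_eq0 mulf_eq0 pnatr_eq0/= => /orP[|/eqP//].
by rewrite -[0]/(0%:C) (inj_eq (@complexI _)) gt_eqF.
Qed.

(** [2 a = h - i k] with [h] and [k] self-adjoint. *)
Lemma derivation_eq0 a : D a = 0.
Proof.
pose h := a + star a; pose k := 'i%C *: (a - star a).
have Dh : D h = 0.
  by apply: derivation_selfadjoint; rewrite /h starD starK addrC.
have Dk : D k = 0.
  apply: derivation_selfadjoint; rewrite /k starZ starB starK.
  by rewrite conj_iC -opprB scalerN scaleNr opprK.
have : D (h + - 'i%C *: k) = 0 by rewrite DD DZ Dh Dk scaler0 addr0.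
rewrite /h /k scalerA mulNr -expr2 sqr_i opprK scale1r.
rewrite addrACA subrr addr0 DD -mulr2n -scaler_nat => /eqP.
by rewrite scaler_eq0 pnatr_eq0 => /eqP.
Qed.

End derivations.

(** * The uniform boundedness principle *)

Section uniform_boundedness.
Variables (R : realType) (V : completeNormedModType R[i]).
Variables (W : normedModType R[i]) (I : Type) (f : I -> V -> W).
Hypothesis f_linear : forall i, linear (f i).
Hypothesis f_bounded : forall i, exists C, forall x, rnorm (f i x) <= C * rnorm x.

Let fD i x y : f i (x + y) = f i x + f i y.
Proof. by have := f_linear i 1 x y; rewrite !scale1r. Qed.

Let f0 i : f i 0 = 0.
Proof. by apply: (@addrI _ (f i 0)); rewrite -fD !addr0. Qed.

Let fZ i l x : f i (l *: x) = l *: f i x.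
Proof. by have := f_linear i l x 0; rewrite f0 !addr0. Qed.

Let fB i x y : f i (x - y) = f i x - f i y.
Proof. by rewrite fD -scaleN1r fZ scaleN1r. Qed.

(** Some [f i] is large at a vector [y] of norm [r / 2]. Since
    [2 f i y = f i (a + y) - f i (a - y)], it is as large at one of [a + y], [a - y], and it stays
    large on a small ball around that point. *)
Let large_on_ball :
  ~ (exists K, forall i x, rnorm (f i x) <= K * rnorm x) ->
  forall (n : nat) (a : V) (r : R), 0 < r -> exists (b : V) (s : R), [/\ 0 < s,
    rnorm (b - a) <= r - s & exists i, forall z, rnorm (z - b) <= s ->
    n%:R < rnorm (f i z)].
Proof.
move=> unb n a r r0; pose m : R := n%:R + 1.
have [i [x Kx]] : exists i x, 2 * m / r * rnorm x < rnorm (f i x).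
  apply: contrapT => h; apply: unb; exists (2 * m / r) => i x.
  by rewrite leNgt; apply/negP => ix; apply: h; exists i, x.
have [C fC] := f_bounded i.
have x0 : 0 < rnorm x.
  apply: rnorm_gt0; apply: contraTneq Kx => ->.
  by rewrite f0 !rnorm0 mulr0 ltxx.
pose y := (r / 2 / rnorm x)%:C *: x.
have c0 : 0 < r / 2 / rnorm x by rewrite !divr_gt0.
have yr : rnorm y = r / 2 by rewrite rnormZr gtr0_norm// divfK// gt_eqF.
have fy : m < rnorm (f i y).
  rewrite fZ rnormZr gtr0_norm//; rewrite -(ltr_pM2l c0) in Kx.
  apply: le_lt_trans Kx; rewrite le_eqVlt; apply/orP; left; apply/eqP.
  by field; rewrite !gt_eqF.
have [b [ba fb]] : exists b, rnorm (b - a) = r / 2 /\ m < rnorm (f i b).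
  apply: contrapT => h.
  have h1 : rnorm (f i (a + y)) <= m.
    rewrite leNgt; apply/negP => h1; apply: h; exists (a + y).
    by rewrite addrC addKr.
  have h2 : rnorm (f i (a - y)) <= m.
    rewrite leNgt; apply/negP => h2; apply: h; exists (a - y).
    by rewrite addrAC subrr add0r rnormN.
  have := rnormB (f i (a + y)) (f i (a - y)).
  rewrite -fB.
  have -> : a + y - (a - y) = y + y by rewrite opprB addrC addrA subrK.
  have -> : f i (y + y) = (2 : R)%:C *: f i y.
    by rewrite fD rmorph_nat scaler_nat mulr2n.
  by rewrite rnormZr normr_nat; lra.
have C0 : 0 <= C.
  have := le_trans (rnorm_ge0 _) (fC x).
  by rewrite pmulr_lge0.
have C1 : 0 < C + 1 by lra.
(* The radius [r / 2] keeps the new ball inside the old one; [(C + 1)^-1] keeps the variation of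
   [f i] within 1, the margin between [m] and [n]. *)
exists b, (Num.min (r / 2) (C + 1)^-1); split.
- by rewrite lt_min invr_gt0 C1 divr_gt0.
- have : Num.min (r / 2) (C + 1)^-1 <= r / 2 by rewrite ge_min lexx.
  by rewrite ba; lra.
exists i => z; rewrite le_min => /andP[_ zb].
have := rnormB (f i z) (f i (z - b)); rewrite -fB subKr => h.
have : C * rnorm (z - b) <= 1.
  apply: le_trans (_ : C * (C + 1)^-1 <= _); first by rewrite ler_wpM2l.
  by rewrite ler_pdivrMr// mul1r lerDl.
by have := fC (z - b); move: fb h; rewrite /m; lra.
Qed.

(* Otherwise one finds nested balls, on the [n]-th of which some [f i] exceeds
   [n]; the [f i] are then unbounded at their common point. *)
Lemma uniform_boundedness :
  (forall x, exists K, forall i, rnorm (f i x) <= K) ->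
  exists K, forall i x, rnorm (f i x) <= K * rnorm x.
Proof.
move=> ptw; apply: contrapT => /large_on_ball step.
(* The guard on the radius makes the relation total, as [choice] requires. *)
pose next (s : nat * (V * R)) (b : V * R) := 0 < s.2.2 -> [/\ 0 < b.2,
  rnorm (b.1 - s.2.1) <= s.2.2 - b.2 & exists i, forall z,
  rnorm (z - b.1) <= b.2 -> s.1%:R < rnorm (f i z)].
have /choice[g gP] : forall s, exists b, next s b.
  case=> n [a r]; have [r0|r0] := ltP 0 r; last first.
    by exists (a, r) => /= h; move: r0; rewrite leNgt h.
  by have [b [s h]] := step n a r r0; exists (b, s).
have [s [s0 sS]] : exists s : nat -> V * R,
    s 0%N = (0, 1) /\ forall n, s n.+1 = g (n, s n).
  by exists (fix s n := if n is m.+1 then g (m, s m) else (0, 1)).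
have r0 n : 0 < (s n).2.
  elim: n => [|n IH]; first by rewrite s0.
  by rewrite sS; have [] := gP (n, s n) IH.
have t_le0 n : - (s n).2 <= 0 by rewrite oppr_le0 ltW.
have t_maj n : rnorm ((s n.+1).1 - (s n).1) <= - (s n.+1).2 - - (s n).2.
  by have [_ /= h _] := gP (n, s n) (r0 n); rewrite sS opprK; move: h; lra.
(* The comparison sequence is minus the radius, so the limit of the centres lies in every ball. *)
have [l [lr _]] := majorised_cvg t_le0 t_maj.
have [K fK] := ptw l.
have := archi_boundP (normr_ge0 K); set n := Num.bound _ => Kn.
have [_ _ [i /(_ l)]] := gP (n, s n) (r0 n); rewrite -sS /= => h.
have : n%:R < rnorm (f i l) by apply: h; have := lr n.+1; rewrite sub0r opprK.
by have := fK i; have := ler_norm K; move: Kn; lra.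
Qed.

End uniform_boundedness.

(** * Hilbert modules: linear spans, inner product estimates, rank-one operators *)

Lemma linear_span_ind (R : realType) (V : lmodType R[i]) (S : set V)
    (P : V -> Prop) :
  P 0 -> (forall u v, P u -> P v -> P (u + v)) ->
  (forall l u, P u -> P (l *: u)) -> (forall u, S u -> P u) ->
  forall u, linear_span S u -> P u.
Proof.
move=> P0 PD PZ PS _ [n [l [s [sS ->]]]].
by apply: big_ind => // i _; apply: PZ; exact: PS.
Qed.

Section hilbert_module.
Variables (R : realType) (A : unitalCStarAlgType R).
Variable M : hilbertModType A.
Implicit Types (x y z u v : M) (a b : A) (l : R[i]) (T S : hmod_end M).

Lemma hdotDl x y z : hdot (x + y) z = hdot x z + hdot y z.
Proof. by have := hdot_linear 1 x y z; rewrite !scale1r. Qed.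

Lemma hdot0l y : hdot 0 y = 0.
Proof. by apply: (@addrI _ (hdot 0 y)); rewrite -hdotDl !addr0. Qed.

Lemma hdotZl l x y : hdot (l *: x) y = l *: hdot x y.
Proof. by have := hdot_linear l x 0 y; rewrite hdot0l !addr0. Qed.

Lemma hdotDr x y z : hdot x (y + z) = hdot x y + hdot x z.
Proof. by rewrite hdot_star hdotDl starD -!hdot_star. Qed.

Lemma hdotZr l x y : hdot x (l *: y) = Num.conj l *: hdot x y.
Proof. by rewrite hdot_star hdotZl starZ -hdot_star. Qed.

Lemma hdotNl x y : hdot (- x) y = - hdot x y.
Proof. by rewrite -scaleN1r hdotZl scaleN1r. Qed.

Lemma hdotNr x y : hdot x (- y) = - hdot x y.
Proof. by rewrite -scaleN1r hdotZr rmorphN1 scaleN1r. Qed.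

Lemma rnorm_hdot x : rnorm (hdot x x) = rnorm x ^+ 2.
Proof.
apply: complexI; rewrite rnormC.
transitivity ((rnorm x)%:C ^+ 2); last by rewrite rmorphXn.
by rewrite rnormC hdot_norm sqrtCK.
Qed.

Lemma hdot_polarization x y : (4 : R[i]) *: hdot x y =
  hdot (x + y) (x + y) - hdot (x - y) (x - y)
  + 'i%C *: (hdot (x + 'i%C *: y) (x + 'i%C *: y)
             - hdot (x - 'i%C *: y) (x - 'i%C *: y)).
Proof.
have h z : hdot (x + z) (x + z) - hdot (x - z) (x - z) =
    (2 : R[i]) *: (hdot x z + hdot z x).
  rewrite !hdotDl !hdotDr !hdotNl !hdotNr opprK [hdot z x + _]addrC addrACA.
  rewrite [- _ + hdot z z]addrC [X in _ - X]addrACA -opprD opprB.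
  by rewrite [_ + (_ + hdot z x)]addrC addrACA subrr addr0 scaler_nat mulr2n.
have i2 : 'i%C * - 'i%C = 1 :> R[i] by rewrite mulrN -expr2 sqr_i opprK.
have -> : 'i%C *: (hdot (x + 'i%C *: y) (x + 'i%C *: y)
    - hdot (x - 'i%C *: y) (x - 'i%C *: y)) = (2 : R[i]) *: (hdot x y - hdot y x).
  rewrite h scalerA mulrC -scalerA hdotZl hdotZr conj_iC scalerDr !scalerA i2.
  by rewrite -expr2 sqr_i scale1r scaleN1r.
rewrite h -scalerDr addrACA subrr addr0.
by rewrite -mulr2n !scaler_nat -mulrnA.
Qed.

(* Polarization gives a Cauchy-Schwarz inequality up to a constant without any
   recourse to positivity. *)
Lemma rnorm_hdot_le x y : rnorm (hdot x y) <= 4 * rnorm x * rnorm y.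
Proof.
(* Each of the four terms of the polarization identity has norm at most [2 ^ 2]. *)
have unit u v : rnorm u <= 1 -> rnorm v <= 1 -> rnorm (hdot u v) <= 4.
  move=> u1 v1; have sq z : rnorm z <= 1 -> rnorm (hdot (u + z) (u + z)) <= 4.
    move=> z1; rewrite rnorm_hdot.
    by have := rnormD u z; have := rnorm_ge0 (u + z); nra.
  have iN z : rnorm ('i%C *: z) = rnorm z.
    by rewrite rnormZ normc_def/= expr0n expr1n add0r sqrtr1 mul1r.
  have := sq v v1; have := sq (- v).
  have := sq ('i%C *: v); have := sq (- ('i%C *: v)).
  rewrite !rnormN iN => /(_ v1) h1 /(_ v1) h2 /(_ v1) h3 h4.
  have := congr1 (@rnorm R A) (hdot_polarization u v).
  have -> : (4 : R[i]) = (4 : R)%:C by rewrite rmorph_nat.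
  rewrite rnormZr ger0_norm// => h.
  rewrite -(ler_pM2l (_ : 0 < 4 :> R))// h.
  apply: le_trans (rnormD _ _) _.
  have iN' a : rnorm ('i%C *: a) = rnorm a.
    by rewrite rnormZ normc_def/= expr0n expr1n add0r sqrtr1 mul1r.
  rewrite iN'; have := rnormB (hdot (u + v) (u + v)) (hdot (u - v) (u - v)).
  have := rnormB (hdot (u + 'i%C *: v) (u + 'i%C *: v))
    (hdot (u - 'i%C *: v) (u - 'i%C *: v)).
  lra.
have [->|/rnorm_gt0 x0] := eqVneq x 0.
  by rewrite hdot0l !rnorm0 mulr0 mul0r.
have [->|/rnorm_gt0 y0] := eqVneq y 0.
  by rewrite hdot_star hdot0l rnorm_star !rnorm0 mulr0.
have n z : 0 < rnorm z -> rnorm ((rnorm z)^-1%:C *: z) <= 1.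
  by move=> z0; rewrite rnormZr gtr0_norm ?invr_gt0// mulVf// gt_eqF.
have := unit _ _ (n x x0) (n y y0).
rewrite hdotZl hdotZr conj_realC !rnormZr !gtr0_norm ?invr_gt0//.
by rewrite mulrA -invfM ler_pdivrMl ?mulr_gt0// mulrC mulrA.
Qed.

Lemma rnorm_act a x : rnorm (act a x) <= rnorm a * rnorm x.
Proof.
rewrite -(ler_pXn2r (_ : 0 < 2)%N) ?nnegrE ?mulr_ge0 ?rnorm_ge0//.
rewrite -rnorm_hdot hdot_act hdot_star hdot_act.
apply: le_trans (rnorm_mul _ _) _; rewrite rnorm_star.
have := rnorm_mul a (hdot x x); rewrite rnorm_hdot.
by have := rnorm_ge0 a; nra.
Qed.

Lemma bounded_AlinearP (f : M -> M) (C : R) : linear f ->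
  (forall a x, f (act a x) = act a (f x)) ->
  (forall x, rnorm (f x) <= C * rnorm x) -> f \in @bounded_Alinear R A M.
Proof.
move=> fl fa fC; apply/asboolP; split => //; exists C%:C => x.
have -> : C%:C * `|x| = (C * rnorm x)%:C by rewrite -rnormC rmorphM.
exact/rnorm_leP.
Qed.

Lemma hmod_end_linear T : linear T.
Proof. by case: (hmod_end_prop T). Qed.

Lemma hmod_end_act T a x : T (act a x) = act a (T x).
Proof. by case: (hmod_end_prop T). Qed.

Lemma hmod_end0 T : T 0 = 0.
Proof.
have := hmod_end_linear T 1 0 0; rewrite !scale1r addr0 => h.
by apply: (@addrI _ (T 0)); rewrite -h addr0.
Qed.

Lemma rnorm_end T x : rnorm (T x) <= rnorm T * rnorm x.
Proof.
rewrite -lecR; have -> : (rnorm T * rnorm x)%:C = `|T| * `|x|.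
  by rewrite -!rnormC rmorphM.
by rewrite rnormC; exact: opnormP.
Qed.

Lemma rnorm_hdot_end T x y :
  rnorm (hdot (T x) y) <= rnorm T * (4 * rnorm x * rnorm y).
Proof.
apply: le_trans (rnorm_hdot_le _ _) _.
have := ler_wpM2r (rnorm_ge0 y) (rnorm_end T x); lra.
Qed.

Lemma rnorm_end_le T (C : R) : (forall x, rnorm x <= 1 -> rnorm (T x) <= C) ->
  rnorm T <= C.
Proof.
move=> TC; apply/rnorm_leP; apply: opnorm_le => x x1; apply/rnorm_leP/TC.
by apply/rnorm_leP.
Qed.

Lemma rank_one_subproof x y : (fun z => act (hdot z y) x) \in @bounded_Alinear R A M.
Proof.
apply: (@bounded_AlinearP _ (4 * rnorm y * rnorm x)) => [l u v|a u|z].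
- by rewrite hdot_linear actDl actZl.
- by rewrite hdot_act actM.
apply: le_trans (rnorm_act _ _) _.
by have := rnorm_hdot_le z y; have := rnorm_ge0 x; nra.
Qed.
Definition rank_one x y : hmod_end M := HmodEnd (rank_one_subproof x y).

Hypothesis A_comm : commutative (fun a b : A => a * b).

(** Commutativity of [A] is what makes [act a] commute with the action. *)
Lemma multiplication_subproof a : act a \in @bounded_Alinear R A M.
Proof.
apply: (@bounded_AlinearP _ (rnorm a)) => [l u v|b u|z].
- by rewrite actDr actZr.
- by rewrite -!actM A_comm.
- exact: rnorm_act.
Qed.
Definition multiplication a : hmod_end M := HmodEnd (multiplication_subproof a).

Lemma rank_one_sandwich T x y u v :
  rank_one u v * T * rank_one x y = multiplication (hdot (T x) v) * rank_one u y.
Proof.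
apply: hmod_endP => z; rewrite !hmod_mulE /=.
by rewrite hmod_end_act hdot_act -actM A_comm.
Qed.

(** * Boundedness of a derivation of the endomorphism algebra *)

Section derivation.
Variable d : hmod_end M -> hmod_end M.
Hypothesis d_der : is_derivation d.

Let d_linear : linear d. Proof. by case: d_der. Qed.
Let dM S T : d (S * T) = d S * T + S * d T. Proof. by case: d_der. Qed.

(** With [y = d (multiplication a) x] held fixed, [b |-> <d (multiplication b) x, y>] is a
    derivation of [A], hence zero; its value at [b = a] is [<y, y>]. *)
Lemma derivation_multiplication a : d (multiplication a) = 0.
Proof.
apply: hmod_endP => x; apply: hdot_eq0; set y := d _ x.
apply: (derivation_eq0 A_comm (D := fun a => hdot (d (multiplication a) x) y)).
  move=> l b c; rewrite -hdot_linear; congr hdot.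
  have -> : multiplication (l *: b + c) = l *: multiplication b + multiplication c.
    by apply: hmod_endP => z; rewrite /= actDl actZl.
  by rewrite d_linear.
move=> b c; have -> : multiplication (b * c) = multiplication b * multiplication c.
  by apply: hmod_endP => z; rewrite /= actM.
rewrite dM [X in hdot X](_ : _ = d (multiplication b) (act c x) +
  act b (d (multiplication c) x))//.
by rewrite hmod_end_act hdotDl !hdot_act [in X in X + _]A_comm.
Qed.

Lemma derivation_multiplicationM a T : d (multiplication a * T) = multiplication a * d T.
Proof. by rewrite dM derivation_multiplication mul0r add0r. Qed.

(** The left side is the middle Leibniz term, the only one containing [d T]. On the right [T] occurs
    undifferentiated, so each term is bounded by a multiple of its norm. *)
Lemma derivation_rank_one T x y u v z :
  act (hdot (d T x) v * hdot z y) u =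
  act (hdot (T x) v) (d (rank_one u y) z)
  - (act (hdot z y) (d (rank_one u v) (T x))
     + act (hdot (T (d (rank_one x y) z)) v) u).
Proof.
have := congr1 d (rank_one_sandwich T x y u v).
rewrite derivation_multiplicationM dM dM => /esym E.
have : act (hdot (T x) v) (d (rank_one u y) z) =
    d (rank_one u v) (T (act (hdot z y) x))
    + act (hdot (d T (act (hdot z y) x)) v) u
    + act (hdot (T (d (rank_one x y) z)) v) u.
  exact: (congr1 (fun S : hmod_end M => S z) E).
rewrite !hmod_end_act hdot_act => ->.
set p := act (hdot z y) _; set q := act (hdot (T _) v) u.
by rewrite (addrAC p) [p + q + _]addrC addrK A_comm.
Qed.

(** Pairing the previous identity with [w] bounds the coefficient times [<z, y> <u, w>], hence times
    any product of two elements of the span [S]. Fullness provides [s] in [S] close to 1, and the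
    factor [s * s] can be removed. *)
Lemma derivation_coefficient_bound x v : full M ->
  exists K, forall T, rnorm (hdot (d T x) v) <= K * rnorm T.
Proof.
move=> M_full.
pose bounded b := exists K, forall T, rnorm (hdot (d T x) v * b) <= K * rnorm T.
have boundedD b c : bounded b -> bounded c -> bounded (b + c).
  move=> [K hK] [L hL]; exists (K + L) => T; rewrite mulrDr mulrDl.
  by apply: le_trans (rnormD _ _) _; apply: lerD.
have boundedZ l b : bounded b -> bounded (l *: b).
  move=> [K hK]; exists (complex.Re `|l| * K) => T; rewrite -scale_mulAr rnormZ.
  by rewrite -mulrA ler_wpM2l// -lecR RRe_real ?normr_real// normr_ge0.
have bounded0 : bounded 0 by exists 0 => T; rewrite mulr0 rnorm0 mul0r.
pose S : set A := linear_span [set a : A | exists x y : M, a = hdot x y].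
have bounded_dot z y u w : bounded (hdot z y * hdot u w).
  (* Bounds for the three terms on the right of [derivation_rank_one], up to the factor
     [rnorm T]. *)
  pose k1 := 4 * rnorm x * rnorm v * rnorm (d (rank_one u y) z).
  pose k2 := rnorm (hdot z y) * (rnorm (d (rank_one u v)) * rnorm x).
  pose k3 := 4 * rnorm (d (rank_one x y) z) * rnorm v * rnorm u.
  exists (4 * (k1 + k2 + k3) * rnorm w) => T.
  rewrite mulrA -hdot_act derivation_rank_one; set V := _ - _.
  have hV : rnorm V <= rnorm T * (k1 + k2 + k3).
    rewrite -addrA mulrDr; apply: le_trans (rnormB _ _) _; apply: lerD.
      apply: le_trans (rnorm_act _ _) _; rewrite mulrA ler_wpM2r ?rnorm_ge0//.
      exact: rnorm_hdot_end.
    rewrite mulrDr; apply: le_trans (rnormD _ _) _; apply: lerD.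
      apply: le_trans (rnorm_act _ _) _; rewrite mulrCA ler_wpM2l ?rnorm_ge0//.
      apply: le_trans (rnorm_end _ _) _; rewrite mulrCA ler_wpM2l ?rnorm_ge0//.
      exact: rnorm_end.
    apply: le_trans (rnorm_act _ _) _; rewrite mulrA ler_wpM2r ?rnorm_ge0//.
    exact: rnorm_hdot_end.
  apply: le_trans (rnorm_hdot_le _ _) _.
  by have := ler_wpM2r (rnorm_ge0 w) hV; lra.
have boundedS b c : S b -> S c -> bounded (b * c).
  move=> Sb Sc; move: b Sb; apply: linear_span_ind => [|b b' hb hb'|l b hb|_ [z [y ->]]].
  - by rewrite mul0r.
  - by rewrite mulrDl; exact: boundedD.
  - by rewrite -scale_mulAl; exact: boundedZ.
  move: c Sc; apply: linear_span_ind => [|b b' hb hb'|l b hb|_ [u [w ->]]].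
  - by rewrite mulr0.
  - by rewrite mulrDr; exact: boundedD.
  - by rewrite -scale_mulAr; exact: boundedZ.
  - exact: bounded_dot.
have [s [Ss s1]] : exists s, S s /\ rnorm ((1 : A) - s) <= 2^-1.
  have : closure S (1 : A) by rewrite M_full.
  move=> /(_ _ (nbhsx_ballx _ (2^-1)%:C _)) [|s [Ss]].
    by rewrite ltcR invr_gt0.
  rewrite -ball_normE /= => s1; exists s; split => //.
  by apply/rnorm_leP; exact: ltW.
(* In [e = e s + e (1 - s)] the last term has norm at most half that of [e]. Two applications give
   the factor 4 below. *)
have double (e : A) : rnorm e <= 2 * rnorm (e * s).
  have := rnormD (e * s) (e * ((1 : A) - s)).
  rewrite -mulrDr addrC subrK mulr1 => h.
  have := rnorm_mul e ((1 : A) - s); have := rnorm_ge0 e; nra.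
have [K hK] := boundedS s s Ss Ss; exists (4 * K) => T.
have := hK T; rewrite mulrA.
have := double (hdot (d T x) v); have := double (hdot (d T x) v * s).
by lra.
Qed.

(** Uniform boundedness over the unit ball of operators is applied first to the functionals given by
    [d T x] for fixed [x], then to the operators [d T] themselves. *)
Lemma derivation_bounded : full M ->
  exists K, forall T, rnorm (d T) <= K * rnorm T.
Proof.
move=> M_full; pose I := {T : hmod_end M | rnorm T <= 1}.
have le_abs (K t : R) : 0 <= t <= 1 -> K * t <= `|K|.
  move=> /andP[t0 t1]; apply: le_trans (ler_norm _) _.
  by rewrite normrM ler_piMr// ger0_norm.
have pointwise x : exists K, forall i : I, rnorm (d (sval i) x) <= K.
  (* The variable [v] stands in the first argument, where [hdot] is linear. *)
  have [||v|K hK] := @uniform_boundedness R M A I (fun i v => hdot v (d (sval i) x)).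
  - by move=> i l u v; rewrite hdot_linear.
  - move=> i; exists (4 * rnorm (d (sval i) x)) => v.
    by have := rnorm_hdot_le v (d (sval i) x); rewrite mulrAC.
  - have [K hK] := derivation_coefficient_bound x v M_full.
    exists (`|K|) => -[T T1] /=; rewrite hdot_star rnorm_star.
    by apply: le_trans (hK T) _; apply: le_abs; rewrite rnorm_ge0.
  (* Testing at [v = d T x] gives [|d T x| ^ 2 <= K |d T x|]. *)
  exists (`|K|) => i; have := hK i (d (sval i) x); rewrite rnorm_hdot expr2.
  have [->|/rnorm_gt0 n0] := eqVneq (d (sval i) x) 0; first by rewrite rnorm0.
  by rewrite ler_pM2r// => /le_trans; apply; exact: ler_norm.
have [||x|K hK] := @uniform_boundedness R M M I (fun i => d (sval i)).
- by move=> i; exact: hmod_end_linear.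
- by move=> i; exists (rnorm (d (sval i))) => x; exact: rnorm_end.
- exact: pointwise.
have dK T : rnorm T <= 1 -> rnorm (d T) <= `|K|.
  move=> T1; apply: rnorm_end_le => x x1.
  by apply: le_trans (hK (exist _ T T1) x) _; apply: le_abs; rewrite rnorm_ge0.
have dD S T : d (S + T) = d S + d T.
  by have := d_linear 1 S T; rewrite !scale1r.
have d0 : d 0 = 0 by apply: (@addrI _ (d 0)); rewrite -dD !addr0.
have dZ l T : d (l *: T) = l *: d T.
  by have := d_linear l T 0; rewrite d0 !addr0.
exists (`|K|) => T; have [->|/rnorm_gt0 T0] := eqVneq T 0.
  by rewrite d0 !rnorm0 mulr0.
have := dK ((rnorm T)^-1%:C *: T); rewrite dZ !rnormZr gtr0_norm ?invr_gt0//.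
by rewrite mulVf ?gt_eqF// => /(_ (lexx _)); rewrite mulrC ler_pdivrMr.
Qed.

End derivation.

End hilbert_module.

(** * Continuity from boundedness *)

Theorem lemma2p2 (R : realType) (A : unitalCStarAlgType R)
  (A_comm : commutative (fun a b : A => a * b))
  (M : hilbertModType A) (M_full : full M)
  (d : hmod_end M -> hmod_end M) (d_der : is_derivation d) :
  continuous d.
Proof.
have [K dK] := derivation_bounded A_comm d_der M_full.
have [d_linear _] := d_der.
(* A positive bound is needed to divide [e] by it; [K] itself may be zero or negative. *)
pose L := `|K| + 1; have L0 : 0 < L by rewrite ltr_wpDl.
move=> T; have FT : Filter (nbhs T) by exact: nbhs_filter.
apply/(@cvgrPdist_le _ _ _ _ FT) => e e0.
have eE : e = (complex.Re e)%:C by rewrite RRe_real// ger0_real// ltW.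
have e0' : 0 < complex.Re e by rewrite -ltcR -eE.
apply/nbhs_ballP; exists (complex.Re e / L)%:C.
  by rewrite /= ltcR divr_gt0.
move=> S; rewrite -ball_normE /= -rnormC ltcR ltr_pdivlMr// => TS.
rewrite eE; apply/rnorm_leP.
have -> : d T - d S = d (T - S).
  by have := d_linear (-1) S T; rewrite !scaleN1r !(addrC (- _)) => ->.
apply: le_trans (dK _) _; apply: le_trans (ltW TS); rewrite mulrC.
by rewrite ler_wpM2l ?rnorm_ge0//; have := ler_norm K; rewrite /L; lra.
Qed.
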